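(* Let $m\ge 2$ and $n\ge m$ be integers, let $X_1,\ldots,X_n$ be i.i.d. random variables with values in a measurable space $\mathcal{X}$, and let $h:\mathcal{X}^m\to\mathbb{R}$ be measurable. Let $m_h=\mathrm{E}\,h(X_1,\ldots,X_m)$, let $U_n(h)$ be the U-statistic of order $m$ with kernel $h$, and let $k=\lfloor n/m\rfloor$. Let $\sigma^2=\mathrm{Var}(h(X_1,\ldots,X_m))$ and $b=\|h-m_h\|_\infty<\infty$. Then for all $t>0$, $$P(U_n(h)-m_h\ge t)\le\exp\left(-\frac{k\sigma^2}{b^2}\,\varphi\!\left(\frac{bt}{\sigma^2}\right)\right),\qquad \varphi(u)=(1+u)\log(1+u)-u.$$
   Context: The U-statistic of order $m$ with kernel $h$ based on $X_1,\ldots,X_n$ is $$U_n(h)=\frac{(n-m)!}{n!}\sum_{(i_1,\ldots,i_m)\in I_n^m}h(X_{i_1},\ldots,X_{i_m}),$$ where $I_n^m=\{(i_1,\ldots,i_m):1\le i_j\le n,\ i_j\ne i_l\text{ if }j\ne l\}$ is the set of all $m$-tuples of distinct integers between $1$ and $n$. The kernel $h$ is not assumed symmetric. $\|\cdot\|_\infty$ denotes the supremum norm over $\mathcal{X}^m$. *)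

(* Defs.v *)
From HB Require Import structures.
From mathcomp Require Import all_boot all_order all_algebra.
From mathcomp Require Import all_classical all_reals all_analysis.

Set Implicit Arguments.
Unset Strict Implicit.
Unset Printing Implicit Defensive.

Import Order.TTheory GRing.Theory Num.Theory.
Import numFieldNormedType.Exports.

Local Open Scope classical_set_scope.
Local Open Scope ring_scope.

Definition mutually_independent (dT dS : measure_display)
    (T : measurableType dT) (S : measurableType dS) (R : realType)
    (P : probability T R) (I : finType) (X : I -> {RV P >-> S}) : Prop :=
  forall (J : {set I}) (A : I -> set S),
    (forall i, measurable (A i)) ->
    P (\bigcap_(i in [set` J]) (X i @^-1` A i)) =
    (\prod_(i in J) P (X i @^-1` A i))%E.

Definition identically_distributed (dT dS : measure_display)
    (T : measurableType dT) (S : measurableType dS) (R : realType)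
    (P : probability T R) (I : finType) (X : I -> {RV P >-> S}) : Prop :=
  forall (i j : I) (A : set S), measurable A ->
    distribution P (X i) A = distribution P (X j) A.

Definition iid (dT dS : measure_display)
    (T : measurableType dT) (S : measurableType dS) (R : realType)
    (P : probability T R) (I : finType) (X : I -> {RV P >-> S}) : Prop :=
  mutually_independent X /\ identically_distributed X.

(* A true supremum over all points, not an essential supremum. *)
Definition sup_norm (S : Type) (R : realType) (f : S -> R) : \bar R :=
  ereal_sup [set `|f x|%:E | x in [set: S]].

(* The m-tuples of distinct indices are the injections 'I_m -> 'I_n. *)
Definition Ustat (R : realType) (S : Type) (m n : nat)
    (h : m.-tuple S -> R) (x : 'I_n -> S) : R :=
  (n - m)`!%:R / n`!%:R *
  \sum_(i : {ffun 'I_m -> 'I_n} | injectiveb i) h [tuple x (i j) | j < m].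

Definition phi (R : realType) (u : R) : R := (1 + u) * ln (1 + u) - u.

(* Main.v *)
Require Import Defs.
From HB Require Import structures.
From mathcomp Require Import all_boot all_order all_algebra.
From mathcomp Require Import fingroup perm.
From mathcomp Require Import ring lra.
From mathcomp Require Import all_classical all_reals all_analysis.
From mathcomp Require Import measurable_realfun.

(** Bennett's inequality for a U-statistic follows Hoeffding's device of writing
    the U-statistic as an average of averages of independent terms.

    Cut 0, ..., k m - 1 into k = n %/ m consecutive blocks of length m. For a
    permutation s of the n indices, let V_s be the mean over the k blocks of
    h evaluated at the observations whose indices are the images under s of the
    block. Every injection from 'I_m to 'I_n extends to a permutation, so for a
    fixed block all injections arise equally often when s varies; hence
    the U-statistic is the mean of the V_s over all s
    ([Ustat_average_perm]). The V_s depend on one another, but convexity of the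
    exponential ([expR_average_le]) allows bounding the moment generating
    function of their mean by the mean of their moment generating functions.
    For a fixed s, the k blocks use disjoint sets of
    observations, so k V_s is a sum of k independent copies of h(X_1, ..., X_m)
    and its moment generating function is a k-th power ([integral_prod_blocks],
    [integral_block], combined in [mgf_Ustat_le]).

    One block is handled by Bennett's estimate ([bennett_mgf]): since
    (e^x - 1 - x) / x^2 takes its maximum on [-c, c] at c, a centred variable Y
    with |Y| <= b satisfies
    E e^(l Y) <= exp (sigma^2 / b^2 (e^(l b) - 1 - l b)). Chernoff's bound with
    l = ln (1 + b t / sigma^2) / b then gives exactly the exponent with phi
    ([bennett_exponent]).

    Independence of functions of disjoint blocks is derived from the product
    rule for events with the pi-lambda theorem: the cylinders over a set
    J of indices form a pi-system generating the sigma-algebra of the X_i with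
    i in J, and independence passes from two pi-systems to the sigma-algebras
    they generate ([indep_generated]). *)

Set Implicit Arguments.
Unset Strict Implicit.
Unset Printing Implicit Defensive.

Import Order.TTheory GRing.Theory Num.Theory.
Import numFieldNormedType.Exports.

Local Open Scope classical_set_scope.
Local Open Scope ring_scope.

(** * Inequalities for the exponential *)

(** In the power series of e^x - 1 - x a factor x^2 comes out, and what is left
    is dominated term by term by the same series at c because |x| <= c. Both
    sides are multiplied out so that x = 0 and c = 0 are covered. *)
Lemma expR_taylor1_ratio_le (R : realType) (x c : R) : `|x| <= c ->
  c ^+ 2 * (expR x - 1 - x) <= x ^+ 2 * (expR c - 1 - c).
Proof.
move=> xc.
have expand (a y : R) :
    (fun n => a * series (exp_coeff y) n) @ \oo --> a * expR y.
  by apply: cvgMl_tmp; exact: is_cvg_series_exp_coeff.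
suff le_series : c ^+ 2 * expR x - x ^+ 2 * expR c <=
    c ^+ 2 * (1 + x) - x ^+ 2 * (1 + c) by lra.
have lim_diff : (fun n => c ^+ 2 * series (exp_coeff x) n -
    x ^+ 2 * series (exp_coeff c) n) @ \oo -->
    c ^+ 2 * expR x - x ^+ 2 * expR c.
  by apply: cvgB; exact: expand.
rewrite -(cvg_lim _ lim_diff)//.
apply: limr_le; first exact: cvgP lim_diff.
near=> n.
have n2 : (2 <= n)%N by near: n; exists 2%N.
rewrite -(subnKC n2) /series/= add2n !big_nat_recl//= /exp_coeff/=.
rewrite !expr0 !expr1 !divr1.
set u := \sum_(0 <= i < _) _; set v := \sum_(0 <= i < _) _.
suff : c ^+ 2 * u <= x ^+ 2 * v by lra.
rewrite !mulr_sumr; apply: ler_sum => i _.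
have split_pow (y z : R) : y ^+ 2 * (z ^+ i.+2 / i.+2`!%:R) =
    y ^+ 2 * z ^+ 2 * z ^+ i / i.+2`!%:R.
  by rewrite -(mulrA (y ^+ 2)) -exprD mulrA.
rewrite !split_pow (mulrC (x ^+ 2)) ler_wpM2r ?invr_ge0//.
apply: ler_wpM2l; first by rewrite mulr_ge0 ?sqr_ge0.
apply: (le_trans (ler_norm (x ^+ i))).
by rewrite normrX lerXn2r ?nnegrE//; exact: le_trans xc.
Unshelve. all: by end_near. Qed.

(** Jensen's inequality for a uniform mean c, from the tangent of the
    exponential at c: the linear terms cancel in the sum. *)
Lemma expR_average_le (R : realType) (I : finType) (a : I -> R) :
  (0 < #|I|)%N ->
  expR (#|I|%:R^-1 * \sum_i a i) <= #|I|%:R^-1 * \sum_i expR (a i).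
Proof.
move=> I0; have N0 : 0 < #|I|%:R :> R by rewrite ltr0n.
set c := _^-1 * \sum_i a i.
have cE : #|I|%:R * c = \sum_i a i by rewrite mulVKf ?gt_eqF.
rewrite ler_pdivlMl//.
have -> : #|I|%:R * expR c = \sum_i (expR c * (1 + (a i - c))).
  rewrite -mulr_sumr big_split/= sumrB !sumr_const -cE.
  by rewrite -[c *+ _]mulr_natl subrr addr0 mulrC.
apply: ler_sum => i _.
by rewrite -[in leRHS](subrKC c (a i)) expRD ler_wpM2l ?expR_ge0// expR_ge1Dx.
Qed.

(** The choice of l minimises the exponent of the Chernoff bound: it is the
    solution of e^(l b) = 1 + b t / s. *)
Lemma bennett_exponent (R : realType) (s b t : R) : 0 < s -> 0 < b -> 0 < t ->
  let l := ln (1 + b * t / s) / b in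
  s / b ^+ 2 * (expR (l * b) - 1 - l * b) - l * t =
  - (s / b ^+ 2 * phi (b * t / s)).
Proof.
move=> s0 b0 t0 l.
have u0 : 0 < 1 + b * t / s by rewrite addr_gt0// divr_gt0// mulr_gt0.
rewrite /l divfK ?gt_eqF// lnK ?posrE// /phi.
set L := ln _.
by field; rewrite !gt_eqF.
Qed.

(** * Injections as restrictions of permutations *)

(** List the values of i first, then the remaining indices in any order: the
    permutation reads off this list. *)
Lemma perm_extend (n m : nat) (hmn : (m <= n)%N) (i : 'I_m -> 'I_n) :
  injective i -> exists s : {perm 'I_n}, forall j, s (widen_ord hmn j) = i j.
Proof.
move=> inj_i.
pose r := codom i ++ [seq x <- enum 'I_n | x \notin codom i].
have r_uniq : uniq r.
  have i_uniq : uniq (codom i) by rewrite map_inj_uniq ?enum_uniq.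
  rewrite cat_uniq i_uniq filter_uniq ?enum_uniq// andbT/=.
  by apply/hasPn => x; rewrite mem_filter => /andP[].
have r_size : size r = n.
  rewrite -[RHS](size_enum_ord n); apply: perm_size; apply: uniq_perm => //.
    exact: enum_uniq.
  by move=> x; rewrite mem_cat mem_filter mem_enum inE andbT orbN.
pose f (x : 'I_n) := nth x r x.
have f_inj : injective f.
  move=> x y; rewrite /f (set_nth_default y) ?r_size//.
  by move/eqP; rewrite nth_uniq ?r_size// => /eqP /val_inj.
exists (perm f_inj) => j; rewrite permE /f/= nth_cat size_map size_enum_ord.
rewrite ltn_ord (nth_map j) ?size_enum_ord//.
by rewrite nth_ord_enum.
Qed.

(** The permutations act transitively on the injections, so the sum over s does
    not depend on e; both sides are the double sum of F (s o i) over all s and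
    all injections i. *)
Lemma sum_perm_injection (V : nmodType) (n m : nat)
    (F : {ffun 'I_m -> 'I_n} -> V) (e : {ffun 'I_m -> 'I_n}) : injective e ->
  (\sum_(s : {perm 'I_n}) F [ffun j => s (e j)]) *+ (n ^_ m) =
  (\sum_(i : {ffun 'I_m -> 'I_n} | injectiveb i) F i) *+ n`!.
Proof.
move=> inj_e.
have hmn : (m <= n)%N by have := leq_card e inj_e; rewrite !card_ord.
have [se seE] := perm_extend hmn inj_e.
have const (i : {ffun 'I_m -> 'I_n}) : injectiveb i ->
    \sum_(s : {perm 'I_n}) F [ffun j => s (i j)] =
    \sum_(s : {perm 'I_n}) F [ffun j => s (e j)].
  move=> /injectiveP/(perm_extend hmn)[si siE].
  rewrite (reindex_inj (mulgI (si^-1 * se)%g))/=.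
  apply: eq_bigr => s _; congr F; apply/ffunP => j.
  by rewrite !ffunE -siE -seE !permM permK.
transitivity (\sum_(i : {ffun 'I_m -> 'I_n} | injectiveb i)
    \sum_(s : {perm 'I_n}) F [ffun j => s (i j)]).
  rewrite (eq_bigr _ const) sumr_const; congr (_ *+ _).
  by have := card_inj_ffuns 'I_m 'I_n; rewrite !card_ord cardsE.
rewrite exchange_big/=.
transitivity (\sum_(s : {perm 'I_n}) 
    \sum_(i : {ffun 'I_m -> 'I_n} | injectiveb i) F i); last first.
  by rewrite sumr_const -[X in _ = _ *+ X]card_Sn; congr (_ *+ _);
    exact: eq_card.
apply: eq_bigr => s _.
rewrite [RHS](reindex_inj (h :=
  fun i : {ffun 'I_m -> 'I_n} => [ffun j => s (i j)]))/=; last first.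
  move=> i i' /ffunP ii'; apply/ffunP => j.
  by have := ii' j; rewrite !ffunE => /perm_inj.
apply: eq_bigl => i; apply/injectiveP/injectiveP => inj_i x y.
  by rewrite !ffunE => /perm_inj/inj_i.
by move=> xy; apply: inj_i; rewrite !ffunE xy.
Qed.

(** * Independence of generated sigma-algebras *)

Section independence.
Context (R : realType) (dT : measure_display) (T : measurableType dT)
  (P : probability T R).

(** Both sides are finite measures in A that agree on the pi-system G. *)
Lemma indep_generatedl (G : set_system T) (B : set T) :
  G `<=` measurable -> setI_closed G -> G [set: T] -> measurable B ->
  (forall A, G A -> P (A `&` B) = P A * P B)%E ->
  forall A, <<s G >> A -> (P (A `&` B) = P A * P B)%E.
Proof.
move=> mG GI GT mB GB A sA.
pose r : {nonneg R} := NngNum (fine_ge0 (measure_ge0 P B)).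
have PB : P B = r%:num%:E by rewrite fineK// fin_num_measure.
rewrite muleC PB.
apply: (g_sigma_algebra_measure_unique G mG (fun=> [set: T]) _ _
  (mrestr P mB) (mscale r P)) => //.
- by rewrite bigcup_const.
- by move=> C GC; rewrite -[RHS]/(r%:num%:E * P C)%E -PB muleC -GB.
- move=> _; apply: (le_lt_trans (probability_le1 P _) (ltry 1)).
  by rewrite setTI.
Qed.

Lemma indep_generated (G1 G2 : set_system T) :
  G1 `<=` measurable -> setI_closed G1 -> G1 [set: T] ->
  G2 `<=` measurable -> setI_closed G2 -> G2 [set: T] ->
  (forall A B, G1 A -> G2 B -> P (A `&` B) = P A * P B)%E ->
  forall A B, <<s G1 >> A -> <<s G2 >> B -> (P (A `&` B) = P A * P B)%E.
Proof.
move=> mG1 G1I G1T mG2 G2I G2T GG A B sA sB.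
have sub_measurable (G : set_system T) : G `<=` measurable ->
    <<s G >> `<=` measurable.
  by move=> mG; apply: smallest_sub => //; exact: sigma_algebra_measurable.
apply: (indep_generatedl mG1) => //; first exact: sub_measurable sB.
move=> C GC; rewrite setIC muleC.
apply: (indep_generatedl mG2) => //; first exact: mG1.
by move=> D GD; rewrite setIC muleC GG.
Qed.

(** Independence says that the joint law of U and V is the product of their
    laws, so Tonelli's theorem applies to the function x y. *)
Lemma integral_mul_indep (U V : {RV P >-> R}) :
  (forall w, 0 <= U w) -> (forall w, 0 <= V w) ->
  (forall A B, measurable A -> measurable B ->
    P (U @^-1` A `&` V @^-1` B) = P (U @^-1` A) * P (V @^-1` B))%E ->
  (\int[P]_w (U w * V w)%:E = \int[P]_w (U w)%:E * \int[P]_w (V w)%:E)%E.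
Proof.
move=> U0 V0 UV.
have mUV : measurable_fun [set: T] (fun w => (U w, V w)).
  exact: measurable_fun_pair.
pose W : {mfun T >-> (R * R)%type} := HB.pack (fun w => (U w, V w))
  (isMeasurableFun.Build _ _ _ _ _ mUV).
(* The truncation makes the integrand nonnegative on all of R; U and V do not
   see it. *)
pose g (r : R) : \bar R := (Num.max 0 r)%:E.
have mg : measurable_fun [set: R] g.
  by apply/measurable_EFinP; apply: measurable_maxr.
have g0 r : (0 <= g r)%E by rewrite lee_fin le_max lexx.
have gE (Y : {RV P >-> R}) : (forall w, 0 <= Y w) ->
    (\int[distribution P Y]_y g y = \int[P]_w (Y w)%:E)%E.
  move=> Y0; rewrite ge0_integral_distribution//.
  by apply: eq_integral => w _; rewrite /= /g max_r.
pose f (z : R * R) : \bar R := (g z.1 * g z.2)%E.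
have mf : measurable_fun [set: (R * R)%type] f.
  by apply: emeasurable_funM; exact: measurableT_comp.
have f0 z : (0 <= f z)%E by rewrite mule_ge0.
transitivity (\int[distribution P W]_z f z)%E.
  rewrite ge0_integral_distribution//; apply: eq_integral => w _ /=.
  by rewrite /f/= /g !max_r// EFinM.
transitivity (\int[distribution P U \x distribution P V]_z f z)%E.
  apply: eq_measure_integral => A mA _; apply/esym.
  by apply: product_measure_unique => // B C mB mC; exact: UV.
rewrite fubini_tonelli1//= -(gE V)// -(gE U)//.
rewrite -ge0_integralZr//; last exact: integral_ge0.
by apply: eq_integral => x _; rewrite /fubini_F /f/= ge0_integralZl.
Qed.
End independence.

(** * Cylinders over a set of indices *)

Lemma measurable_mktuple (dT dS : measure_display) (T : measurableType dT)
    (S : measurableType dS) (m : nat) (f : 'I_m -> T -> S) :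
  (forall j, measurable_fun [set: T] (f j)) ->
  measurable_fun [set: T] (fun w => [tuple f j w | j < m]).
Proof.
move=> mf; apply/measurable_fun_tnthP => j.
rewrite (_ : _ \o _ = f j)//.
by apply/funext => w /=; rewrite tnth_mktuple.
Qed.

Section cylinders.
Context (dT dS : measure_display) (T : measurableType dT)
  (S : measurableType dS) (I : finType).

(** This is a pi-system, and the sigma-algebra it generates is the one generated
    by the X i with i in J. *)
Definition cylinders (X : I -> T -> S) (J : {set I}) : set_system T :=
  [set C | exists2 A : I -> set S, forall i, measurable (A i) &
    C = \bigcap_(i in [set` J]) X i @^-1` A i].

Lemma cylinders_setI (X : I -> T -> S) (J : {set I}) :
  setI_closed (cylinders X J).
Proof.
move=> _ _ [A mA ->] [B mB ->]; exists (fun i => A i `&` B i).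
  by move=> i; exact: measurableI.
by rewrite -bigcapI.
Qed.

Lemma cylinders_setT (X : I -> T -> S) (J : {set I}) :
  cylinders X J [set: T].
Proof. by exists (fun=> setT) => //; rewrite bigcapT. Qed.

Lemma cylinders_measurable (X : I -> {mfun T >-> S}) (J : {set I}) :
  cylinders X J `<=` measurable.
Proof.
move=> _ [A mA ->]; apply: fin_bigcap_measurable => // i _.
exact: measurable_funPTI.
Qed.

Lemma measurable_coord (X : I -> T -> S) (J : {set I}) (i : I) : i \in J ->
  measurable_fun [set: g_sigma_algebraType (cylinders X J)]
    (X i : g_sigma_algebraType (cylinders X J) -> S).
Proof.
move=> iJ _ A mA; rewrite setTI; apply: sub_sigma_algebra.
exists (fun k => if k == i then A else setT).
  by move=> k; case: ifP.
apply/seteqP; split=> [w Xw k _|w]; first by rewrite /=; case: eqP => [->|].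
by move/(_ i iJ); rewrite eqxx.
Qed.

(** Only coordinates in J are used, so a function of the block is an observable
    of the smaller sigma-algebra, hence independent of whatever depends on
    the coordinates outside J. *)
Lemma measurable_block (X : I -> T -> S) (J : {set I}) (R : realType) (m : nat)
    (g : m.-tuple S -> R) (e : 'I_m -> I) :
  measurable_fun [set: m.-tuple S] g -> (forall j, e j \in J) ->
  measurable_fun [set: g_sigma_algebraType (cylinders X J)]
    (fun w : g_sigma_algebraType (cylinders X J) =>
      g [tuple X (e j) w | j < m]).
Proof.
move=> mg eJ; apply: (measurableT_comp mg).
by apply: measurable_mktuple => j; exact: measurable_coord.
Qed.
End cylinders.

(** * Blocks of independent observations *)

Section iid_blocks.
Context (R : realType) (dT dS : measure_display) (T : measurableType dT)
  (S : measurableType dS) (P : probability T R) (I : finType)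
  (X : I -> {RV P >-> S}).

Lemma cylinders_indep (J1 J2 : {set I}) (A B : set T) :
  mutually_independent X -> [disjoint J1 & J2]%B ->
  cylinders X J1 A -> cylinders X J2 B -> (P (A `&` B) = P A * P B)%E.
Proof.
move=> indepX J12 [A1 mA1 ->] [A2 mA2 ->].
(* J1 and J2 being disjoint, one family of sides describes both cylinders. *)
pose C i := if i \in J1 then A1 i else A2 i.
have C1 i : i \in J1 -> C i = A1 i by rewrite /C => ->.
have C2 i : i \in J2 -> C i = A2 i.
  by rewrite /C => iJ2; rewrite (disjointFl J12 iJ2).
have mC i : measurable (C i) by rewrite /C; case: ifP.
have -> : \bigcap_(i in [set` J1]) X i @^-1` A1 i =
    \bigcap_(i in [set` J1]) X i @^-1` C i.
  by apply: eq_bigcapr => i /= iJ1; rewrite C1.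
have -> : \bigcap_(i in [set` J2]) X i @^-1` A2 i =
    \bigcap_(i in [set` J2]) X i @^-1` C i.
  by apply: eq_bigcapr => i /= iJ2; rewrite C2.
rewrite -bigcap_setU.
have -> : [set` J1] `|` [set` J2] = [set` (J1 :|: J2)%SET].
  by apply/seteqP; split=> i /=; rewrite inE => /orP.
rewrite !indepX// -bigU//=.
by apply: eq_bigl => i; rewrite !inE.
Qed.

Lemma mutually_independent_reindex (K : finType) (e : K -> I) (A : K -> set S) :
  mutually_independent X -> injective e -> (forall j, measurable (A j)) ->
  (P (\bigcap_j X (e j) @^-1` A j) = \prod_j P (X (e j) @^-1` A j))%E.
Proof.
move=> indepX inj_e mA.
(* The indices that e misses carry the trivial constraint. *)
pose C i := if [pick j | e j == i] is Some j then A j else setT.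
have CE j : C (e j) = A j.
  rewrite /C; case: pickP => [j' /eqP/inj_e ->//|/(_ j)].
  by rewrite eqxx.
have mC i : measurable (C i) by rewrite /C; case: pickP.
have -> : \bigcap_j X (e j) @^-1` A j =
    \bigcap_(i in [set` (e @: [set: K])%SET]) X i @^-1` C i.
  apply/seteqP; split=> w AX.
    by move=> i /= /imsetP[j _ ->]; rewrite CE; exact: AX.
  by move=> j _; rewrite /= -CE; apply: AX => /=; exact: imset_f.
rewrite indepX// big_imset/=; last by move=> ? ? _ _; exact: inj_e.
by apply: eq_big => [j|j _]; rewrite ?inE ?CE.
Qed.

(** Induction on the list of blocks: the first block lives on the index set J,
    the remaining ones on its complement. *)
Lemma integral_prod_blocks (K : eqType) (s : seq K) (m : nat)
    (e : K -> 'I_m -> I) (g : m.-tuple S -> R) :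
  mutually_independent X -> uniq s ->
  (forall l l' j j', e l j = e l' j' -> l = l') ->
  measurable_fun [set: m.-tuple S] g -> (forall x, 0 <= g x) ->
  (\int[P]_w (\prod_(l <- s) g [tuple X (e l j) w | j < m])%:E =
   \prod_(l <- s) \int[P]_w (g [tuple X (e l j) w | j < m])%:E)%E.
Proof.
move=> indepX + inj_e mg g0.
elim: s => [_|l s IH /=/andP[ls s_uniq]].
  under eq_integral do rewrite big_nil.
  by rewrite big_nil integral_cst//= mul1e; exact: probability_setT.
pose J := [set e l j | j : 'I_m]%SET.
pose G1 := cylinders X J; pose G2 := cylinders X (~: J)%SET.
pose U w := g [tuple X (e l j) w | j < m].
pose V w := \prod_(l' <- s) g [tuple X (e l' j) w | j < m].
have mU1 : measurable_fun [set: g_sigma_algebraType G1]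
    (U : g_sigma_algebraType G1 -> R).
  by apply: measurable_block => // j; exact: imset_f.
have mV2 : measurable_fun [set: g_sigma_algebraType G2]
    (V : g_sigma_algebraType G2 -> R).
  apply: measurable_prod => l' l's; apply: measurable_block => // j.
  rewrite inE; apply/imsetP => -[j' _ /inj_e ll'].
  by rewrite -ll' l's in ls.
have coarser J' : <<s cylinders X J' >> `<=` measurable.
  apply: smallest_sub; first exact: sigma_algebra_measurable.
  exact: cylinders_measurable.
have mU : measurable_fun [set: T] U.
  by move=> _ A mA; apply: coarser; exact: mU1.
have mV : measurable_fun [set: T] V.
  by move=> _ A mA; apply: coarser; exact: mV2.
pose U' : {RV P >-> R} := HB.pack U (isMeasurableFun.Build _ _ _ _ _ mU).
pose V' : {RV P >-> R} := HB.pack V (isMeasurableFun.Build _ _ _ _ _ mV).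
rewrite big_cons -IH//.
under eq_integral do rewrite big_cons.
rewrite (integral_mul_indep (U := U') (V := V'))//.
- by move=> w; exact: g0.
- by move=> w; apply: prodr_ge0 => l' _; exact: g0.
- move=> A B mA mB.
  apply: (@indep_generated _ _ _ P G1 G2).
  + exact: cylinders_measurable.
  + exact: cylinders_setI.
  + exact: cylinders_setT.
  + exact: cylinders_measurable.
  + exact: cylinders_setI.
  + exact: cylinders_setT.
  + move=> C D; apply: cylinders_indep => //.
    by rewrite finset.disjoints_subset finset.setCK.
  + by rewrite -[X in <<s _ >> X]setTI; exact: mU1.
  + by rewrite -[X in <<s _ >> X]setTI; exact: mV2.
Qed.

(** By independence and equality of the marginals, the two blocks give the same
    mass to every rectangle, so they have the same law. *)
Lemma integral_block (m : nat) (e e' : 'I_m -> I) (g : m.-tuple S -> R) :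
  iid X -> injective e -> injective e' ->
  measurable_fun [set: m.-tuple S] g -> (forall x, 0 <= g x) ->
  (\int[P]_w (g [tuple X (e j) w | j < m])%:E =
   \int[P]_w (g [tuple X (e' j) w | j < m])%:E)%E.
Proof.
move=> [indepX idX] inj_e inj_e' mg g0.
have mB (f : 'I_m -> I) :
    measurable_fun [set: T] (fun w => [tuple X (f j) w | j < m]).
  by apply: measurable_mktuple => j; exact: measurable_funPT.
pose B f : {mfun T >-> m.-tuple S} :=
  HB.pack (fun w => [tuple X (f j) w | j < m])
    (isMeasurableFun.Build _ _ _ _ _ (mB f)).
have law f : (\int[P]_w (g [tuple X (f j) w | j < m])%:E =
    \int[distribution P (B f)]_x (g x)%:E)%E.
  by rewrite ge0_integral_distribution//; exact/measurable_EFinP.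
rewrite !law; apply: eq_measure_integral => A mA _.
(* The rectangles are the cylinders of the coordinate projections. *)
pose G := cylinders (fun j => (@tnth m S)^~ j) [set: 'I_m]%SET.
have sub_sG : measurable `<=` <<s G >>.
  have mid : measurable_fun [set: g_sigma_algebraType G]
      (id : g_sigma_algebraType G -> m.-tuple S).
    by apply/measurable_fun_tnthP => j; apply: measurable_coord; rewrite inE.
  by move=> C mC; rewrite -[C]setTI; exact: mid.
have GE f : injective f -> forall C : 'I_m -> set S,
    (forall j, measurable (C j)) ->
    distribution P (B f) (\bigcap_(j in [set` [set: 'I_m]%SET])
      (@tnth m S)^~ j @^-1` C j) = (\prod_j P (X (f j) @^-1` C j))%E.
  move=> inj_f C mC; rewrite -mutually_independent_reindex//; congr (P _).
  apply/seteqP; split=> w BC j _; have := BC j; rewrite /= tnth_mktuple.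
    by apply; rewrite inE.
  exact.
apply: (g_sigma_algebra_measure_unique G _ (fun=> [set: _])).
- move=> _ [C mC ->]; apply: fin_bigcap_measurable => // j _.
  by rewrite -[X in measurable X]setTI; exact: measurable_tnth.
- by move=> _; exact: cylinders_setT.
- by rewrite bigcup_const.
- exact: cylinders_setI.
- move=> _ [C mC ->]; apply: etrans (GE e inj_e C mC) _.
  apply: etrans _ (esym (GE e' inj_e' C mC)).
  by apply: eq_bigr => j _; exact: idX.
- by move=> _; apply: (le_lt_trans (probability_le1 _ _) (ltry 1)).
- exact: sub_sG.
Qed.
End iid_blocks.

(** * Bennett's bound for one centred bounded variable *)

Section bounded.
Context (R : realType) (dT : measure_display) (T : measurableType dT)
  (P : probability T R).

Lemma integrable_of_bound (f : T -> R) (M : R) : measurable_fun [set: T] f ->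
  (forall w, `|f w| <= M) -> P.-integrable [set: T] (EFin \o f).
Proof.
move=> mf fM; apply: measurable_bounded_integrable => //.
  exact: (le_lt_trans (probability_le1 P _) (ltry 1)).
exists M; split; first exact: num_real.
move=> x Mx w _ /=; apply: (le_trans (fM w)); exact: ltW.
Qed.

(** Expand e^(l Y) to second order: [expR_taylor1_ratio_le] bounds the remainder
    by a constant times Y^2, the linear term has mean zero, and 1 + x <= e^x. *)
Lemma bennett_mgf (Y : T -> R) (b s l : R) : measurable_fun [set: T] Y ->
  0 < b -> 0 < l -> (forall w, `|Y w| <= b) ->
  (\int[P]_w (Y w)%:E = 0)%E -> (\int[P]_w (Y w ^+ 2)%:E = s%:E)%E ->
  (\int[P]_w (expR (l * Y w))%:E <=
   (expR (s / b ^+ 2 * (expR (l * b) - 1 - l * b)))%:E)%E.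
Proof.
move=> mY b0 l0 Yb EY EY2.
pose c := (expR (l * b) - 1 - l * b) / b ^+ 2.
have exp_le w : expR (l * Y w) <= 1 + (l * Y w + c * Y w ^+ 2).
  have : `|l * Y w| <= l * b by rewrite normrM gtr0_norm// ler_pM2l.
  move=> /expR_taylor1_ratio_le ratio_le.
  rewrite -2!lerBlDl -(@ler_pM2l _ ((l * b) ^+ 2)) ?exprn_gt0 ?mulr_gt0//.
  have -> : (l * b) ^+ 2 * (c * Y w ^+ 2) =
      (l * Y w) ^+ 2 * (expR (l * b) - 1 - l * b).
    by rewrite /c; field; rewrite gt_eqF.
  exact: ratio_le.
have mlY : measurable_fun [set: T] (fun w => l * Y w).
  exact: measurable_funM.
have mY2 : measurable_fun [set: T] (fun w => Y w ^+ 2).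
  exact: measurable_funX.
have iY : P.-integrable [set: T] (EFin \o Y) by exact: integrable_of_bound Yb.
have iY2 : P.-integrable [set: T] (EFin \o (fun w => Y w ^+ 2)).
  apply: (integrable_of_bound (M := b ^+ 2)) => // w.
  by rewrite normrX lerXn2r ?nnegrE// ltW.
have ilY : P.-integrable [set: T] (fun w => l%:E * (Y w)%:E)%E.
  exact: integrableZl.
have icY2 : P.-integrable [set: T] (fun w => c%:E * (Y w ^+ 2)%:E)%E.
  by apply: integrableZl.
have i1 : P.-integrable [set: T] (fun w => 1%:E : \bar R).
  apply: (integrable_of_bound (f := cst 1) (M := 1)) => // w.
  by rewrite normr1.
have isum := integrableD measurableT ilY icY2.
apply: (@le_trans _ _ (1 + c * s)%:E); last first.
  have -> : s / b ^+ 2 * (expR (l * b) - 1 - l * b) = c * s.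
    by rewrite /c; ring.
  by rewrite lee_fin expR_ge1Dx.
apply: (@le_trans _ _
  (\int[P]_w (1%:E + (l%:E * (Y w)%:E + c%:E * (Y w ^+ 2)%:E)))%E).
  apply: le_integral => //.
  - apply: (integrable_of_bound (f := fun w => expR (l * Y w))
      (M := expR (l * b))).
      exact: measurableT_comp.
    move=> w; rewrite ger0_norm ?expR_ge0// ler_expR ler_pM2l//.
    by rewrite (le_trans (ler_norm _)).
  - exact: (integrableD measurableT i1 isum).
  - by move=> w _; rewrite lee_fin; exact: exp_le.
rewrite (integralD measurableT i1 isum) (integralD measurableT ilY icY2).
rewrite (integralZl measurableT iY) (integralZl measurableT iY2).
rewrite integral_cst//= [in leLHS]probability_setT.
rewrite EY EY2 mule0 add0e mul1e.
by rewrite -EFinM -EFinD.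
Qed.
End bounded.

(** * Hoeffding's decomposition of the U-statistic *)

(** Since the n ^_ m injections are hit equally often, averaging over all
    permutations is averaging over all injections, whatever e is. *)
Lemma Ustat_average_perm (R : realType) (S : Type) (m n : nat)
    (h : m.-tuple S -> R) (x : 'I_n -> S) (e : 'I_m -> 'I_n) : injective e ->
  Ustat h x = n`!%:R^-1 *
    \sum_(s : {perm 'I_n}) h [tuple x (s (e j)) | j < m].
Proof.
move=> inj_e.
have hmn : (m <= n)%N by have := leq_card e inj_e; rewrite !card_ord.
pose F (i : {ffun 'I_m -> 'I_n}) := h [tuple x (i j) | j < m].
have inj_fe : injective [ffun j => e j] by move=> i j; rewrite !ffunE => /inj_e.
have := sum_perm_injection F inj_fe.
have -> : \sum_(s : {perm 'I_n}) F [ffun j => s ([ffun j => e j] j)] =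
    \sum_(s : {perm 'I_n}) h [tuple x (s (e j)) | j < m].
  apply: eq_bigr => s _; congr h; apply: eq_from_tnth => j.
  by rewrite !tnth_mktuple !ffunE.
rewrite /Ustat -/(F _).
set A := \sum_s _; set B := \sum_(i | _) _ => AB.
have f0 k : k`!%:R != 0 :> R by rewrite pnatr_eq0 -lt0n fact_gt0.
have ff0 : (n ^_ m)%:R != 0 :> R by rewrite pnatr_eq0 -lt0n ffact_gt0.
apply: (mulfI ff0).
have -> : (n ^_ m)%:R * (n`!%:R^-1 * A) = B.
  by rewrite mulrCA mulr_natl AB -[B *+ _]mulr_natl mulKf.
by rewrite mulrA mulrA -natrM ffact_fact// divff// mul1r.
Qed.

Lemma block_index_lt (n m l j : nat) : (l < n %/ m)%N -> (j < m)%N ->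
  (l * m + j < n)%N.
Proof.
move=> ln jm; apply: (@leq_trans (l.+1 * m)).
  by rewrite mulSn addnC ltn_add2r.
by rewrite (leq_trans _ (leq_divM n m))// leq_mul2r ln orbT.
Qed.

Definition block_index (n m : nat) (l : 'I_(n %/ m)) (j : 'I_m) : 'I_n :=
  Ordinal (block_index_lt (ltn_ord l) (ltn_ord j)).

Lemma block_index_inj (n m : nat) (l l' : 'I_(n %/ m)) (j j' : 'I_m) :
  block_index l j = block_index l' j' -> l = l' /\ j = j'.
Proof.
move=> /(congr1 val)/= E.
have m0 : (0 < m)%N by apply: leq_ltn_trans (ltn_ord j).
split; apply: val_inj => /=.
  have := congr1 (divn^~ m) E; rewrite !divnMDl//.
  by rewrite (divn_small (ltn_ord j)) (divn_small (ltn_ord j')) !addn0.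
by have := congr1 (modn^~ m) E; rewrite !modnMDl !modn_small.
Qed.

Lemma measurable_Ustat (R : realType) (dT dS : measure_display)
    (T : measurableType dT) (S : measurableType dS) (m n : nat)
    (X : 'I_n -> {mfun T >-> S}) (h : m.-tuple S -> R) :
  measurable_fun [set: m.-tuple S] h ->
  measurable_fun [set: T] (fun w => Ustat h (fun i => X i w)).
Proof.
move=> meas_h; apply: measurable_funM => //.
under eq_fun do rewrite -big_filter.
apply: measurable_sum => i; apply: (measurableT_comp meas_h).
by apply: measurable_mktuple => j; exact: measurable_funPT.
Qed.

(** By convexity the left-hand side is at most a mean over the permutations of
    moment generating functions of sums over blocks; each of these is a
    product of n %/ m equal factors. *)
Lemma mgf_Ustat_le (R : realType) (dT dS : measure_display)
    (T : measurableType dT) (S : measurableType dS) (P : probability T R)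
    (m n : nat) (hmn : (m <= n)%N) (X : 'I_n -> {RV P >-> S}) (hX : iid X)
    (h : m.-tuple S -> R) (mh l M : R) :
  measurable_fun [set: m.-tuple S] h ->
  (\int[P]_w (expR (l * (h [tuple X (widen_ord hmn j) w | j < m] - mh)))%:E
    <= M%:E)%E ->
  (\int[P]_w
     (expR ((n %/ m)%:R * l * (Ustat h (fun i => X i w) - mh)))%:E
   <= (M ^+ (n %/ m))%:E)%E.
Proof.
move=> meas_h leM; have [indepX _] := hX; set k := (n %/ m)%N.
pose g x := expR (l * (h x - mh)).
have g0 x : 0 <= g x by exact: expR_ge0.
have mg : measurable_fun [set: m.-tuple S] g.
  apply: measurableT_comp => //; apply: measurable_funM => //.
  exact: measurable_funB.
pose B (s : {perm 'I_n}) (q : 'I_k) w :=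
  [tuple X (s (block_index q j)) w | j < m].
pose W s w := \prod_(q : 'I_k) g (B s q w).
have W0 s w : 0 <= W s w by apply: prodr_ge0 => q _; exact: g0.
have mX (s : {perm 'I_n}) q : measurable_fun [set: T] (B s q).
  by apply: measurable_mktuple => j; exact: measurable_funPT.
have mW s : measurable_fun [set: T] (W s).
  by apply: measurable_prod => q _; exact: measurableT_comp.
have widen_inj : injective (widen_ord hmn).
  by move=> i j /(congr1 val) /= ij; apply: val_inj.
set c := (\int[P]_w _)%E in leM.
have c0 : (0 <= c)%E by apply: integral_ge0 => w _; rewrite lee_fin expR_ge0.
have c_fin : c \is a fin_num by rewrite ge0_fin_numE// (le_lt_trans leM)// ltry.
have EW s : (\int[P]_w (W s w)%:E = (fine c ^+ k)%:E)%E.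
  rewrite (integral_prod_blocks (P := P) (X := X)
    (e := fun q j => s (block_index q j)))//.
  - rewrite (eq_bigr (fun=> (fine c)%:E)); last first.
      move=> q _; rewrite fineK//.
      apply: (integral_block hX) => // i j /perm_inj /block_index_inj[] //.
    by rewrite prodEFin prodr_const card_ord.
  - exact: index_enum_uniq.
  - by move=> q q' j j' /perm_inj /block_index_inj[].
have NE : #|{perm 'I_n}| = n`!.
  by rewrite -[RHS]card_Sn; apply: eq_card.
have N0 : (0 < #|{perm 'I_n}|)%N by rewrite NE fact_gt0.
set N := #|{perm 'I_n}| in N0 NE.
have U_avg w : k%:R * l * (Ustat h (fun i => X i w) - mh) =
    N%:R^-1 * \sum_(s : {perm 'I_n}) \sum_(q : 'I_k) l * (h (B s q w) - mh).
  set U := Ustat _ _.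
  have sumU q : \sum_(s : {perm 'I_n}) l * (h (B s q w) - mh) =
      N%:R * (l * (U - mh)).
    rewrite -mulr_sumr sumrB sumr_const -/N.
    have block_q_inj : injective (@block_index n m q).
      by move=> i j /block_index_inj[].
    rewrite /U (Ustat_average_perm h _ block_q_inj) -NE.
    by rewrite -[mh *+ N]mulr_natl; field; rewrite pnatr_eq0 -lt0n.
  rewrite exchange_big/= (eq_bigr _ (fun q _ => sumU q)) sumr_const card_ord.
  by rewrite -[_ *+ k]mulr_natl; field; rewrite pnatr_eq0 -lt0n.
have jensen w : expR (k%:R * l * (Ustat h (fun i => X i w) - mh)) <=
    N%:R^-1 * \sum_(s : {perm 'I_n}) W s w.
  rewrite U_avg (le_trans (expR_average_le _ N0))//.
  by rewrite ler_pM2l ?invr_gt0 ?ltr0n// ler_sum// => s _; rewrite expR_sum.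
apply: (@le_trans _ _ (\int[P]_w (N%:R^-1%:E *
    \sum_(s : {perm 'I_n}) (W s w)%:E))%E).
  apply: ge0_le_integral => //.
  - apply/measurable_EFinP; apply: measurableT_comp => //.
    apply: measurable_funM => //; apply: measurable_funB => //.
    exact: measurable_Ustat.
  - apply: measurable_funeM; apply: emeasurable_sum => s.
    exact/measurable_EFinP.
  - by move=> w _; rewrite sumEFin lee_fin jensen.
rewrite ge0_integralZl_EFin ?invr_ge0//; last 2 first.
- by move=> w _; rewrite sumEFin lee_fin sumr_ge0.
- by apply: emeasurable_sum => s; exact/measurable_EFinP.
rewrite ge0_integral_sum//; last 2 first.
- by move=> s; exact/measurable_EFinP.
- by move=> s w _; rewrite lee_fin.
rewrite (eq_bigr _ (fun s _ => EW s)) sumEFin -EFinM lee_fin sumr_const.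
rewrite -/N -[X in _ * X <= _]mulr_natl mulKf ?pnatr_eq0 -?lt0n//.
by rewrite lerXn2r ?nnegrE ?fine_ge0// -lee_fin ?fineK// (le_trans c0).
Qed.

(** * Bennett's inequality for U-statistics *)

Theorem theorem3p5 (R : realType) (dT dS : measure_display)
    (T : measurableType dT) (S : measurableType dS) (P : probability T R)
    (m n : nat) (hm : (2 <= m)%N) (hmn : (m <= n)%N)
    (X : 'I_n -> {RV P >-> S}) (hX : iid X)
    (h : m.-tuple S -> R) (hh : measurable_fun [set: m.-tuple S] h) :
  let hX1m := fun w : T => h [tuple X (widen_ord hmn j) w | j < m] in
  let mh : R := fine ('E_P[hX1m])%E in
  let sigma2 : R := fine ('V_P[hX1m])%E in
  let k : nat := (n %/ m)%N in
  (sup_norm (fun x => (h x - mh)%R) < +oo)%E ->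
  let b : R := fine (sup_norm (fun x => h x - mh)) in
  forall t : R, 0 < t ->
  (P [set w | (t <= Ustat h (fun i => X i w) - mh)%R] <=
   (expR (- (k%:R * sigma2 / b ^+ 2 * phi (b * t / sigma2)))%R)%:E)%E.
Proof.
move=> hX1m mh sigma2 k supoo b t t0.
have m0 : (0 < m)%N by exact: ltn_trans hm.
have k0 : (0 < k)%N by rewrite divn_gt0.
have mhX : measurable_fun [set: T] hX1m.
  apply: (measurableT_comp hh).
  by apply: measurable_mktuple => j; exact: measurable_funPT.
have mU : measurable_fun [set: T] (fun w => Ustat h (fun i => X i w) - mh).
  by apply: measurable_funB => //; exact: measurable_Ustat.
(* As 1 / 0 = 0, the right-hand side is 1 when sigma2 or b vanishes. *)
have trivial_bound : sigma2 = 0 \/ b = 0 ->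
    (P [set w | (t <= Ustat h (fun i => X i w) - mh)%R] <=
   (expR (- (k%:R * sigma2 / b ^+ 2 * phi (b * t / sigma2)))%R)%:E)%E.
  move=> degenerate.
  have -> : k%:R * sigma2 / b ^+ 2 = 0.
    by case: degenerate => ->; rewrite ?expr0n ?invr0 ?(mulr0, mul0r).
  rewrite mul0r oppr0 expR0 probability_le1//.
  rewrite -[X in measurable X]setTI.
  exact: measurable_fun_le.
have h_le x : `|h x - mh| <= b.
  have sup_ge : (`|h x - mh|%:E <= sup_norm (fun x => h x - mh)%R)%E.
    by apply: ereal_sup_ubound; exists x.
  have sup_fin : sup_norm (fun x => h x - mh)%R \is a fin_num.
    by rewrite ge0_fin_numE// (le_trans _ sup_ge)// lee_fin.
  by rewrite -lee_fin /b fineK.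
have [b0|b0] := eqVneq b 0; first by apply: trivial_bound; right.
have [s0|s0] := eqVneq sigma2 0; first by apply: trivial_bound; left.
have b_gt0 : 0 < b.
  by rewrite lt_neqAle eq_sym b0 (le_trans (normr_ge0 _) (h_le point)).
pose Y w := hX1m w - mh.
have mY : measurable_fun [set: T] Y by exact: measurable_funB.
have Y_le w : `|Y w| <= b by exact: h_le.
have iX : P.-integrable [set: T] (EFin \o hX1m).
  apply: (integrable_of_bound P (M := b + `|mh|)) => // w.
  by rewrite -[hX1m w](subrK mh) (le_trans (ler_normD _ _))// lerD2r h_le.
have EX : (\int[P]_w (hX1m w)%:E = mh%:E)%E.
  by rewrite /mh unlock fineK// integrable_fin_num.
have EY : (\int[P]_w (Y w)%:E = 0)%E.
  have imh : P.-integrable [set: T] (EFin \o cst mh).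
    by apply: (integrable_of_bound P (M := `|mh|)).
  rewrite /Y; under eq_integral do rewrite EFinB.
  have Ecst : (\int[P]_w mh%:E = mh%:E)%E.
    by rewrite -[RHS](expectation_cst P) unlock.
  by rewrite (integralB_EFin measurableT iX imh) EX Ecst subee.
have EY2 : (\int[P]_w (Y w ^+ 2)%:E = sigma2%:E)%E.
  have iY2 : P.-integrable [set: T] (EFin \o (fun w => Y w ^+ 2)).
    apply: (integrable_of_bound P (M := b ^+ 2)); first exact: measurable_funX.
    by move=> w; rewrite normrX lerXn2r ?nnegrE// ltW.
  have VE : ('V_P[hX1m] = \int[P]_w (Y w ^+ 2)%:E)%E.
    transitivity (expectation P (fun w => Y w ^+ 2)); last by rewrite unlock.
    by rewrite /variance covariance.unlock.
  by rewrite /sigma2 VE fineK// integrable_fin_num.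
have s_gt0 : 0 < sigma2.
  rewrite lt_neqAle eq_sym s0 -lee_fin -EY2 integral_ge0// => w _.
  by rewrite lee_fin sqr_ge0.
pose l := ln (1 + b * t / sigma2) / b.
have l0 : 0 < l.
  rewrite divr_gt0// ln_gt0// ltrDl divr_gt0//; exact: mulr_gt0.
have mgf := bennett_mgf mY b_gt0 l0 Y_le EY EY2.
have mgfU := mgf_Ustat_le hX hh mgf.
pose Z : {RV P >-> R} := HB.pack (fun w => Ustat h (fun i => X i w) - mh)
  (isMeasurableFun.Build _ _ _ _ _ mU).
have kl0 : 0 < k%:R * l by rewrite mulr_gt0// ltr0n.
apply: le_trans (chernoff Z t kl0) _.
have MZ : ('M_P Z (k%:R * l) <=
    (expR (sigma2 / b ^+ 2 * (expR (l * b) - 1 - l * b)) ^+ k)%:E)%E.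
  suff -> : ('M_P Z (k%:R * l) = \int[P]_w
      (expR (k%:R * l * (Ustat h (fun i => X i w) - mh)))%:E)%E.
    exact: mgfU.
  rewrite /mmt_gen_fun unlock.
  by apply: eq_integral => w _ /=; rewrite mulrC.
apply: le_trans (lee_wpmul2r _ MZ) _; first by rewrite lee_fin expR_ge0.
rewrite -EFinM lee_fin -expRM_natl -expRD ler_expR.
have exponentE := bennett_exponent s_gt0 b_gt0 t0; rewrite -/l /= in exponentE.
have -> : k%:R * sigma2 / b ^+ 2 * phi (b * t / sigma2) =
    k%:R * (sigma2 / b ^+ 2 * phi (b * t / sigma2)) by rewrite !mulrA.
by rewrite -[leRHS]mulrN -exponentE [leRHS]mulrBr !mulrA.
Qed.
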